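(* Let $\mu_1=0$, $\mu_2>0$ and suppose $b_1=b_2=\varepsilon_0=1$. Then the first return map $\mathcal G_{(0,\mu_2)}=Loc_2\circ\Psi_{1\to2}\circ Loc_1\circ\Psi_{2\to1}$ to $\mathrm{Out}(\mathbf C_2)\setminus W^s(\mathbf C_1)$ (at points mapped by $\Psi_{2\to1}$ into $\mathrm{In}^+(\mathbf C_1)$) may be written as $\mathcal G_{(0,\mu_2)}(\overline y,\overline\theta)=(\mathcal G_1,\mathcal G_2)$, where $$\mathcal G_1=\mu_2^{\delta-1}\big[\overline y+\phi_2(\overline y,\overline\theta)\big]^{\delta},$$ $$\mathcal G_2=\overline\theta+\xi+\mu_2\psi_2(\overline y,\overline\theta)-\omega K_G\ln(\mu_2)-\omega K_G\ln\big[\overline y+\phi_2(\overline y,\overline\theta)\big],$$ with $\delta=\delta_1\delta_2$, $\xi=\xi_1+\xi_2$ and $K_G=\dfrac1{e_1+w_2^{(1)}}+\dfrac{\delta_1}{e_2+w_2^{(2)}}$.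
   Context: Setting: a flow with two hyperbolic periodic solutions $\mathbf C_1,\mathbf C_2$, depending on $\mu=(\mu_1,\mu_2)$, frequency $\omega>0$, saddle exponents $-c_i<0<e_i$ with $c_i>e_i$. Near $\mathbf C_i$, in rescaled coordinates $(y_1^{(i)},y_2^{(i)},\theta^{(i)})$, $\theta^{(i)}\in\mathbb S^1$, the flow is $$\dot y_1^{(i)}=(-c_i+\|\mu\|g_1^{(i)})y_1^{(i)},\quad \dot y_2^{(i)}=(e_i+\|\mu\|g_2^{(i)})y_2^{(i)},\quad\dot\theta^{(i)}=\omega,$$ with $g_j^{(i)}$ functions of $(y_1^{(i)},y_2^{(i)},\theta^{(i)};\mu)$. Cross sections: $\mathrm{In}(\mathbf C_i)\subset\{y_1^{(i)}=\varepsilon_0/\|\mu\|\}$ with coordinates $(y_2^{(i)},\theta^{(i)})$; $\mathrm{In}^+(\mathbf C_i)$ is its part with $y_2^{(i)}>0$, and $y_2^{(i)}=0$ is the local stable manifold of $\mathbf C_i$; $\mathrm{Out}(\mathbf C_i)\subset\{y_2^{(i)}=\varepsilon_0/\|\mu\|\}$ with coordinates $(\overline y_1^{(i)},\overline\theta^{(i)})$. For the orbit starting at $q_0\in\mathrm{In}^+(\mathbf C_i)$ put $w_j^{(i)}=\frac1t\int_0^t\|\mu\|g_j^{(i)}\,ds$ (integral along the orbit), evaluated at $t=$ the time of flight to $\mathrm{Out}(\mathbf C_i)$, and $\delta_i=\dfrac{c_i-w_1^{(i)}}{e_i+w_2^{(i)}}$ (functions of $q_0$ and $\mu$). The local maps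 $Loc_i:\mathrm{In}^+(\mathbf C_i)\to\mathrm{Out}(\mathbf C_i)$ are $$\overline y_1^{(i)}=\frac{\varepsilon_0}{\|\mu\|}\Big[\frac{\varepsilon_0}{\|\mu\|y_2^{(i)}}\Big]^{-\delta_i},\qquad\overline\theta^{(i)}=\theta^{(i)}+\frac{\omega}{e_i+w_2^{(i)}}\ln\Big(\frac{\varepsilon_0}{\|\mu\|y_2^{(i)}}\Big).$$ The global maps are $\Psi_{1\to2}:\mathrm{Out}(\mathbf C_1)\to\mathrm{In}(\mathbf C_2)$, $y_2^{(2)}=b_1\overline y_1^{(1)}+\frac{\mu_1}{\|\mu\|}\phi_1(\overline y_1^{(1)},\overline\theta^{(1)})$, $\theta^{(2)}=\overline\theta^{(1)}+\xi_1+\mu_1\psi_1(\overline y_1^{(1)},\overline\theta^{(1)})$; $\Psi_{2\to1}:\mathrm{Out}(\mathbf C_2)\to\mathrm{In}(\mathbf C_1)$, $y_2^{(1)}=b_2\overline y_1^{(2)}+\frac{\mu_2}{\|\mu\|}\phi_2(\overline y_1^{(2)},\overline\theta^{(2)})$, $\theta^{(1)}=\overline\theta^{(2)}+\xi_2+\mu_2\psi_2(\overline y_1^{(2)},\overline\theta^{(2)})$, with $b_i\neq0$, $\xi_i\in\mathbb R$, $\phi_1>0$ and $\phi_i,\psi_i$ real functions. In the claim $(\overline y,\overline\theta)=(\overline y_1^{(2)},\overline\theta^{(2)})\in\mathrm{Out}(\mathbf C_2)$ and $\delta_i,w_2^{(i)}$ are evaluated at the successive points of the orbit on $\mathrm{In}^+(\mathbf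 C_1)$, $\mathrm{In}^+(\mathbf C_2)$. *)

(* Defs.v *)
From HB Require Import structures.
From mathcomp Require Import all_boot all_order all_algebra.
From mathcomp Require Import generic_quotient ring_quotient.
From mathcomp Require Import all_classical all_reals all_analysis.

Set Implicit Arguments.
Unset Strict Implicit.
Unset Printing Implicit Defensive.

Import Order.TTheory GRing.Theory Num.Theory.
Import numFieldNormedType.Exports.

Local Open Scope classical_set_scope.
Local Open Scope ring_scope.

(* The circle is the additive group R / (2 pi) Z. *)

Definition period (R : realType) : {pred R} :=
  fun x => x / (2 * pi) \is a Num.int.

Fact period_zmod_closed (R : realType) : zmod_closed (@period R).
Proof.
split=> [|x y]; first by rewrite unfold_in /period mul0r rpred0.
move=> px py; rewrite unfold_in /period mulrBl.
by move: px py; rewrite 2!unfold_in /period; apply: rpredB.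
Qed.

Definition periods (R : realType) : zmodClosed R :=
  HB.pack (@period R)
    (GRing.isZmodClosed.Build R (@period R) (@period_zmod_closed R)).

Definition S1 (R : realType) : zmodType := Quotient.quot (periods R).

Definition angle (R : realType) (x : R) : S1 R :=
  \pi_(Quotient.quot (periods R))%qT x.

Lemma angleD (R : realType) (x y : R) : angle (x + y) = angle x + angle y.
Proof. exact: raddfD. Qed.

Lemma angle_eq (R : realType) (x y : R) :
  angle x = angle y <-> (x - y) / (2 * pi) \is a Num.int.
Proof.
have -> : ((x - y) / (2 * pi) \is a Num.int) = (x - y \in periods R) by [].
by rewrite Quotient.idealrBE; split=> /eqP.
Qed.

Section Model.
Context {R : realType}.
Implicit Types (mu : R * R) (omega t T m : R).

Definition norm2 mu : R := Num.sqrt (mu.1 ^+ 2 + mu.2 ^+ 2).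

(* A point of the rescaled neighbourhood of a periodic solution is
   (y1, y2, theta); a point of In is (y2, theta) and one of Out is
   (y1, theta). *)
Definition state : Type := R * R * S1 R.
Definition section_pt : Type := R * S1 R.

Definition y1 (p : state) : R := p.1.1.
Definition y2 (p : state) : R := p.1.2.
Definition theta (p : state) : S1 R := p.2.

(* [orb mu q t] is the point at time t on the orbit starting at the point of
   In with coordinates q, and [flight mu q] the time this orbit takes to reach
   Out: see [is_per_sol] below. *)
Record per_sol := PerSol {
  contr : R;
  expan : R;
  g1 : state -> R * R -> R;
  g2 : state -> R * R -> R;
  InC : R * R -> set section_pt;
  OutC : R * R -> set section_pt;
  orb : R * R -> section_pt -> R -> state;
  flight : R * R -> section_pt -> R }.

Definition InP (C : per_sol) mu : set section_pt := InC C mu `&` [set q | 0 < q.1].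

Definition Wsloc (C : per_sol) mu : set section_pt :=
  InC C mu `&` [set q | q.1 = 0].

Definition has_velocity (x v : R -> R) T : Prop :=
  {within `[0, T], continuous x} /\
  forall t, 0 < t < T -> is_derive t (1 : R) x (v t).

(* The angular equation is expressed on a real lift of the angle. *)
Definition is_solution (C : per_sol) mu omega (p : R -> state) T : Prop :=
  [/\ has_velocity (fun t => y1 (p t))
        (fun t => (- contr C + norm2 mu * g1 C (p t) mu) * y1 (p t)) T,
      has_velocity (fun t => y2 (p t))
        (fun t => (expan C + norm2 mu * g2 C (p t) mu) * y2 (p t)) T
    & exists2 l : R -> R,
        forall t, 0 <= t <= T -> theta (p t) = angle (l t)
        & has_velocity l (fun=> omega) T].

Definition is_flight_time (eps0 : R) mu (p : R -> state) T : Prop :=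
  [/\ 0 < T, y2 (p T) = eps0 / norm2 mu
    & forall t, 0 <= t < T -> y2 (p t) < eps0 / norm2 mu].

Definition w1 (C : per_sol) mu (q : section_pt) t : R :=
  t^-1 * \int[lebesgue_measure]_(s in `[0, t])
           (norm2 mu * g1 C (orb C mu q s) mu).

Definition w2 (C : per_sol) mu (q : section_pt) t : R :=
  t^-1 * \int[lebesgue_measure]_(s in `[0, t])
           (norm2 mu * g2 C (orb C mu q s) mu).

Definition w1F (C : per_sol) mu q : R := w1 C mu q (flight C mu q).
Definition w2F (C : per_sol) mu q : R := w2 C mu q (flight C mu q).

Definition delta (C : per_sol) mu q : R :=
  (contr C - w1F C mu q) / (expan C + w2F C mu q).

Definition Loc (eps0 : R) omega mu (C : per_sol) (q : section_pt) : section_pt :=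
  let r := eps0 / (norm2 mu * q.1) in
  (eps0 / norm2 mu * r `^ (- delta C mu q),
   q.2 + angle (omega / (expan C + w2F C mu q) * ln r)).

Definition is_per_sol (eps0 : R) omega mu (C : per_sol) : Prop :=
  [/\ 0 < expan C, expan C < contr C,
      (forall q, InP C mu q ->
        [/\ orb C mu q 0 = (eps0 / norm2 mu, q.1, q.2),
            is_solution C mu omega (orb C mu q) (flight C mu q)
          & is_flight_time eps0 mu (orb C mu q) (flight C mu q)])
    & forall q, InP C mu q -> OutC C mu (Loc eps0 omega mu C q)].

Record connection := Connection {
  cb : R;
  cxi : R;
  cphi : R -> S1 R -> R;
  cpsi : R -> S1 R -> R }.

(* m is the component of mu that splits this connection: mu_1 for the
   connection from C1 to C2, mu_2 for the one from C2 to C1. *)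
Definition Psi mu (m : R) (K : connection) (q : section_pt) : section_pt :=
  (cb K * q.1 + m / norm2 mu * cphi K q.1 q.2,
   q.2 + angle (cxi K + m * cpsi K q.1 q.2)).

Definition Psi12 mu (K12 : connection) := Psi mu mu.1 K12.
Definition Psi21 mu (K21 : connection) := Psi mu mu.2 K21.

(* First crossings only: points of Out(C2) mapped directly into the local
   stable manifold of C1. *)
Definition WsOut mu (C1 C2 : per_sol) (K21 : connection) : set section_pt :=
  OutC C2 mu `&` (Psi21 mu K21 @^-1` Wsloc C1 mu).

Definition return_map (eps0 : R) omega mu (C1 C2 : per_sol) (K12 K21 : connection) :
    section_pt -> section_pt :=
  Loc eps0 omega mu C2 \o Psi12 mu K12 \o Loc eps0 omega mu C1 \o Psi21 mu K21.

End Model.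

Arguments per_sol : clear implicits.
Arguments connection : clear implicits.
Arguments section_pt : clear implicits.
Arguments state : clear implicits.

(* Main.v *)
Require Import Defs.
From HB Require Import structures.
From mathcomp Require Import all_boot all_order all_algebra.
From mathcomp Require Import all_classical all_reals all_analysis.
From mathcomp Require Import ring.

Set Implicit Arguments.
Unset Strict Implicit.
Unset Printing Implicit Defensive.

Import Order.TTheory GRing.Theory Num.Theory.
Import numFieldNormedType.Exports.

Local Open Scope classical_set_scope.
Local Open Scope ring_scope.

(** With [mu1 = 0] and [mu2 > 0] the norm of [mu] is [mu2]. Hence [Psi21] sends the first coordinate
    to [z = y + cphi K21 y th], while [Psi12] keeps the first coordinate and only rotates the angle
    by [cxi K12]. In the scaled variable [u = mu2 * y] each local map is the pure power
    [u -> u^delta] ([Loc_eps1]), so the two passages compose to [(mu2 z)^(delta1 delta2)]. Each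
    passage also turns the angle by a multiple of [- ln u]; since [ln (u^delta1) = delta1 ln u], the
    two multiples add up to [omega * KG]. *)

Lemma norm2_0l (R : realType) (m : R) : 0 <= m -> norm2 (0, m) = m.
Proof. by move=> m0; rewrite /norm2 /= expr0n add0r sqrtr_sqr ger0_norm. Qed.

(** Inverting the bracket of [Loc] absorbs the minus sign of the exponent and changes the sign of
    the logarithm. *)
Lemma Loc_eps1 (R : realType) (omega : R) (mu : R * R) (C : per_sol R)
    (q : section_pt R) : 0 < norm2 mu * q.1 ->
  Loc 1 omega mu C q =
    ((norm2 mu)^-1 * (norm2 mu * q.1) `^ delta C mu q,
     q.2 + angle (- (omega / (expan C + w2F C mu q) * ln (norm2 mu * q.1)))).
Proof.
move=> p0; rewrite /Loc !div1r lnV ?posrE// mulrN.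
by rewrite -[(_ * _)^-1]powR_inv1 ?ltW// -powRrM mulN1r opprK.
Qed.

Theorem lemma6p5 (R : realType) (mu1 mu2 eps0 omega : R)
    (C1 C2 : per_sol R) (K12 K21 : connection R)
    (homega : 0 < omega)
    (hC1 : is_per_sol eps0 omega (mu1, mu2) C1)
    (hC2 : is_per_sol eps0 omega (mu1, mu2) C2)
    (hb1 : cb K12 != 0) (hb2 : cb K21 != 0)
    (hphi1 : forall (y : R) (th : S1 R),
        OutC C1 (mu1, mu2) (y, th) -> 0 < cphi K12 y th)
    (hPsi12 : forall q : section_pt R, OutC C1 (mu1, mu2) q ->
        InC C2 (mu1, mu2) (Psi12 (mu1, mu2) K12 q))
    (hPsi21 : forall q : section_pt R, OutC C2 (mu1, mu2) q ->
        InC C1 (mu1, mu2) (Psi21 (mu1, mu2) K21 q))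
    (hmu1 : mu1 = 0) (hmu2 : 0 < mu2)
    (b1_1 : cb K12 = 1) (b2_1 : cb K21 = 1) (eps0_1 : eps0 = 1)
    (y : R) (th : S1 R)
    (hOut : (OutC C2 (mu1, mu2) `\` WsOut (mu1, mu2) C1 C2 K21) (y, th))
    (hIn : InP C1 (mu1, mu2) (Psi21 (mu1, mu2) K21 (y, th))) :
  let mu := (mu1, mu2) in
  let q1 := Psi21 mu K21 (y, th) in
  let q2 := Psi12 mu K12 (Loc eps0 omega mu C1 q1) in
  let delta1 := delta C1 mu q1 in
  let delta2 := delta C2 mu q2 in
  let dlt := delta1 * delta2 in
  let xi := cxi K12 + cxi K21 in
  let KG := 1 / (expan C1 + w2F C1 mu q1) + delta1 / (expan C2 + w2F C2 mu q2) in
  InP C2 mu q2 /\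
  return_map eps0 omega mu C1 C2 K12 K21 (y, th) =
    (mu2 `^ (dlt - 1) * (y + cphi K21 y th) `^ dlt,
     th + angle (xi + mu2 * cpsi K21 y th
                 - omega * KG * ln mu2
                 - omega * KG * ln (y + cphi K21 y th))).
Proof.
move=> mu q1 q2 delta1 delta2 dlt xi KG; subst mu1 eps0.
set z := y + cphi K21 y th.
have Nmu : norm2 mu = mu2 by rewrite norm2_0l ?ltW.
have q11 : q1.1 = z.
  by rewrite /q1 /Psi21 /Psi /= -/mu Nmu divff ?gt_eqF// b2_1 !mul1r.
(* Starting in In+ makes [z] positive, so the power and logarithm rules below apply. *)
have z0 : 0 < z by rewrite -q11; case: hIn.
have p0 : 0 < mu2 * z by rewrite mulr_gt0.
have L1 : Loc 1 omega mu C1 q1 = (mu2^-1 * (mu2 * z) `^ delta1,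
    q1.2 + angle (- (omega / (expan C1 + w2F C1 mu q1) * ln (mu2 * z)))).
  by rewrite Loc_eps1 Nmu q11.
have q21 : q2.1 = mu2^-1 * (mu2 * z) `^ delta1.
  by rewrite /q2 L1 /Psi12 /Psi /= b1_1 mul1r !mul0r addr0.
have mu2q21 : mu2 * q2.1 = (mu2 * z) `^ delta1.
  by rewrite q21 mulVKf ?gt_eqF.
have q22 : q2.2 = th + angle (cxi K21 + mu2 * cpsi K21 y th)
    + angle (- (omega / (expan C1 + w2F C1 mu q1) * ln (mu2 * z)))
    + angle (cxi K12).
  by rewrite /q2 L1 /Psi12 /Psi /= mul0r addr0.
split.
  (* The second local map acts on its proper domain: [Loc] sends In+ of [C1] into Out, [hPsi12]
     carries this into In, and a power of a positive number is positive. *)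
  split; last by change (0 < q2.1); rewrite q21 mulr_gt0 ?invr_gt0 ?powR_gt0.
  by apply: hPsi12; case: hC1 => _ _ _; apply.
have -> : return_map 1 omega mu C1 C2 K12 K21 (y, th) = Loc 1 omega mu C2 q2.
  by [].
rewrite Loc_eps1 Nmu mu2q21 ?powR_gt0// q22 ln_powR; congr pair.
  rewrite -powRrM -/dlt powRM ?ltW// mulrA; congr (_ * _).
  by rewrite powRD ?lt0r_neq0 ?implybT// (powR_inv1 (ltW hmu2)) mulrC.
(* All rotations merge into one real lift, and the two lifts agree exactly, not just modulo the
   period. *)
rewrite -!addrA -!angleD lnM ?posrE//; congr (_ + angle _).
by rewrite /KG /xi; ring.
Qed.
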